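(* MGCBS is an optimal solver of the MG-MAPF problem: for every MG-MAPF instance, any collection of paths returned by MGCBS is a solution of the instance whose sum of costs (SOC) is minimum among all solutions of the instance.
   Context: MG-MAPF problem. An instance consists of a finite undirected graph $G=(V,E)$ with unit-length edges, agents $A=\{a_1,\dots,a_k\}$, and for each agent $a_i$ a start vertex $s_i\in V$ and goal vertices $g_i=\{g_i^1,\dots,g_i^{n_i}\}\subseteq V$, $n_i\ge 1$. Time is discrete ($0,1,2,\dots$). At each time step an agent either waits at its current vertex or moves to an adjacent vertex. A path for $a_i$ is a finite sequence of vertices starting at $s_i$ at time $0$, each step being a wait or a move along an edge, which visits every goal of $a_i$ at least once, in arbitrary order, and ends at one of the goals of $a_i$; after the end of its path the agent stays forever at the last vertex at no additional cost. The cost of a path is its number of time steps. Two agents collide if they are at the same vertex at the same time step (vertex conflict; this includes times after an agent has finished) or move along the same edge during the same time step (edge conflict). A solution is a collection of pairwise collision-free paths, one per agent. Its SOC is the sum of the costs of the paths. Constraints and safe intervals. A vertex constraint $(a,t,v)$ forbids agent $a$ from being at $v$ at time $t$ (also after finishing). An edge constraint $(a,t,u,v)$ forbids $a$ from moving from $u$ to $v$ between times $t$ and $t+1$. Fix an agent and a finite set of constraints on it. A TS state is a pair $(t,v)$ (time, vertex); it is safe if it is not forbidden by a vertex constraint. A TIS state $([t_0,t_1],v)$, with $t_1\le+\infty$, is the set of TS states $(t,v)$ with $t\in[t_0,t_1]$; it is safe if all of them are safe. A safe interval (SI) is a safe TIS state whose time interval is maximal. A goal safe interval (GSI) is an SI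 at a goal vertex of the agent. For a TIS state $q$, $q.v$ denotes its vertex. TIS Tree of a seed GSI. Its nodes are safe TIS states with a cost and possibly a parent. Initially there is one node for each SI at each vertex; the seed GSI has cost $0$, all others cost $+\infty$; all nodes are put in a set $U$. Repeatedly remove from $U$ a node $n$ of minimum cost, with TIS state $([t_0,t_1],v)$. For each $v'$ with $(v',v)\in E$ or $v'=v$, let $B$ be the set of maximal time intervals consisting of times $t\ge 0$ such that $(t,v')$ is safe, $t+1\in[t_0,t_1]$, and the transition from $v'$ to $v$ between $t$ and $t+1$ is not forbidden by an edge constraint. For every node $n'$ at $v'$ with cost greater than $\mathrm{cost}(n)+1$ and every interval of $B$: if the time interval of $n'$ is contained in it, set the parent of $n'$ to $n$ and its cost to $\mathrm{cost}(n)+1$; if it is only partly covered, split $n'$ (also in $U$) into nodes according to the coverage and update in this way only the fully covered part. Stop when $U$ is empty. A query $(t,s)$ finds the node whose TIS state contains $(t,s)$; the node's cost is the returned length ($+\infty$ if there is no such node), and the returned path follows the vertices of the nodes along parent pointers up to the seed node. The TIS Forest of an agent consists of the TIS Trees of all its GSIs. Low-level solver (one agent with start vertex $s$, under its constraints). It is an A* search over states $(L,p)$, where $L$ is the set of visited goals and $p$ is the current SI. The initial state is $(\emptyset,p_0)$ with $p_0$ the earliest SI at $s$ and $g$-value $0$. From a state $(L,p)$ with $g$-value $g$ there is a transition to $(L\cup\{q.v\},q)$ for every GSI $q$ with $q.v\notin L$, except that if $q.v$ is the only unvisited goal, only the latest GSI at $q.v$ is allowed. Its cost is the length returned by the TIS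 Tree of $q$ for the query $(g,p.v)$ (transitions of infinite cost are not used). The heuristic value $h$ is the cost of a minimum spanning tree of $p.v$ and all unvisited goals with respect to graph distances in $G$. A state of minimum $f=g+h$ in the open set is moved to the closed set and expanded; states in the closed set are not updated, states in the open set keep the smaller $g$. When a state with all goals visited is removed from the open set, the GSI visiting order is read off by backtracking, and the path is built by concatenating the TIS Tree paths to the successive GSIs of this order. If the open set becomes empty, no path is returned. MGCBS (high-level solver). It maintains a set OPEN of constraint-tree nodes, each with a constraint set, one path per agent, and the SOC of these paths. The root has no constraints and its paths are computed by the low-level solver. Repeatedly remove a node $N$ of minimum SOC from OPEN. If its paths have no collision, return them. Otherwise take the earliest collision; for each of the two agents $a$ involved, form a child node by adding the constraint forbidding $a$'s part in the collision (a vertex constraint $(a,t,v)$ for a vertex conflict at $v$ at time $t$; an edge constraint $(a,t,u,v)$ for an edge conflict in which $a$ moves from $u$ to $v$ between $t$ and $t+1$), rebuild the TIS Forest of $a$, recompute $a$'s path by the low-level solver, and, if a path is returned, insert the child in OPEN. If OPEN becomes empty, no solution is returned. *)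

(* Defs.v *)
From HB Require Import structures.
From mathcomp Require Import all_boot.

Set Implicit Arguments.
Unset Strict Implicit.
Unset Printing Implicit Defensive.

(* Extended naturals; [None] is +oo. *)
Definition xnat := option nat.

Definition xle (x y : xnat) : bool :=
  if y is Some n then (if x is Some m then m <= n else false) else true.
Definition xlt (x y : xnat) : bool := ~~ xle y x.
Definition xadd (x y : xnat) : xnat :=
  if x is Some m then omap (addn m) y else None.
Definition xmin (x y : xnat) : xnat := if xle x y then x else y.

(* Loops of [edge] are harmless: staying at a vertex is always allowed and is
   never regarded as a move. *)
Record mapf_instance (V : finType) := MapfInstance {
  edge : rel V;
  edge_sym : symmetric edge;
  nb_agents : nat;
  start : 'I_nb_agents -> V;
  goals : 'I_nb_agents -> {set V};
  goals_neq0 : forall i, goals i != set0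
}.

Section Problem.
Context {V : finType} (I : mapf_instance V).
Notation agent := 'I_(nb_agents I).

Definition step : rel V := [rel u v | (u == v) || edge I u v].

(* As in [seq.path], the path s_i = v_0, v_1, ..., v_T is represented by the
   sequence v_1, ..., v_T; its cost T is thus the size of this sequence. *)
Definition is_path (i : agent) (p : seq V) : Prop :=
  [/\ path step (start i) p,
      goals i \subset start i :: p
    & last (start i) p \in goals i].

Definition plan := {ffun agent -> seq V}.

Definition pos (P : plan) (i : agent) (t : nat) : V :=
  nth (last (start i) (P i)) (start i :: P i) t.

(* [(a, t, v)] on the left, [(a, t, u, v)] on the right. *)
Definition constraint : eqType := (agent * nat * V + agent * nat * V * V)%type.
Definition vertex_constraint (a : agent) t v : constraint := inl (a, t, v).
Definition edge_constraint (a : agent) t u v : constraint := inr (a, t, u, v).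

(* [conflict P i j t ci cj]: under the plan P, the agents i and j collide at
   time t (for an edge conflict: between t and t + 1), and ci, cj are the
   constraints forbidding to i, resp. j, its part in that collision. *)
Inductive conflict (P : plan) (i j : agent) (t : nat) :
    constraint -> constraint -> Prop :=
| VertexConflict : i != j -> pos P i t = pos P j t ->
    conflict P i j t (vertex_constraint i t (pos P i t))
                     (vertex_constraint j t (pos P j t))
| EdgeConflict : i != j ->
    pos P i t != pos P i t.+1 -> pos P j t != pos P j t.+1 ->
    [set pos P i t; pos P i t.+1] = [set pos P j t; pos P j t.+1] ->
    conflict P i j t (edge_constraint i t (pos P i t) (pos P i t.+1))
                     (edge_constraint j t (pos P j t) (pos P j t.+1)).

Definition collision_free (P : plan) : Prop :=
  forall i j t ci cj, ~ conflict P i j t ci cj.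

Definition solution (P : plan) : Prop :=
  (forall i, is_path i (P i)) /\ collision_free P.

Definition soc (P : plan) : nat := \sum_(i : agent) size (P i).

(* The interval [t0, t1] of times, with t1 <= +oo. *)
Definition tint : eqType := (nat * xnat)%type.
Definition tin (J : tint) (t : nat) : bool := (J.1 <= t) && xle (Some t) J.2.
Definition tint_nonempty (J : tint) : bool := xle (Some J.1) J.2.

Definition max_tint (S : pred nat) (J : tint) : Prop :=
  [/\ tint_nonempty J,
      forall t, tin J t -> S t
    & forall J', tint_nonempty J' -> (forall t, tin J' t -> S t) ->
        (forall t, tin J t -> tin J' t) -> J' = J].

(* The TIS state ([t0, t1], v). *)
Definition tis : eqType := (tint * V)%type.

Section OneAgent.
Variables (C : seq constraint) (a : agent).

Definition safe (t : nat) (v : V) : bool := vertex_constraint a t v \notin C.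

Definition is_SI (q : tis) : Prop := max_tint (fun t => safe t q.2) q.1.
Definition is_GSI (q : tis) : Prop := is_SI q /\ q.2 \in goals a.

Definition earliest_SI (v : V) (q : tis) : Prop :=
  [/\ is_SI q, q.2 = v & forall q', is_SI q' -> q'.2 = v -> q.1.1 <= q'.1.1].
Definition latest_SI (v : V) (q : tis) : Prop :=
  [/\ is_SI q, q.2 = v & forall q', is_SI q' -> q'.2 = v -> q'.1.1 <= q.1.1].
End OneAgent.

End Problem.

Arguments plan {V} I.
Arguments tis V : clear implicits.

(* The TIS states of the nodes of a tree are pairwise distinct, so the parent
   pointer is the TIS state of the parent. [tn_inU] tells whether the node is
   still in the set U. *)
Record tnode (V : finType) := TNode {
  tn_tis : tis V;
  tn_cost : xnat;
  tn_parent : option (tis V);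
  tn_inU : bool
}.

Definition tnode_to_tuple (V : finType) (n : tnode V) :=
  (tn_tis n, tn_cost n, tn_parent n, tn_inU n).
Definition tuple_to_tnode (V : finType)
    (x : tis V * xnat * option (tis V) * bool) : tnode V :=
  let: (q, c, p, b) := x in TNode q c p b.
Lemma tnode_to_tupleK (V : finType) :
  cancel (@tnode_to_tuple V) (@tuple_to_tnode V).
Proof. by case. Qed.
HB.instance Definition _ (V : finType) :=
  Equality.copy (tnode V) (can_type (@tnode_to_tupleK V)).

Section TISTree.
Context {V : finType} (I : mapf_instance V).
Variables (C : seq (constraint I)) (a : 'I_(nb_agents I)) (seed : tis V).

Definition init_node (q : tis V) : tnode V :=
  TNode q (if q == seed then Some 0 else None) None true.

(* The elements of the set B when n is removed from U, for the vertex v'. *)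
Definition in_B (n : tnode V) (v' : V) (J : tint) : Prop :=
  max_tint (fun t => [&& safe C a t v', tin (tn_tis n).1 t.+1
                       & edge_constraint a t v' (tn_tis n).2 \notin C]) J.

Definition next_cost (n : tnode V) : xnat := omap succn (tn_cost n).

(* n' has to be updated through n according to the interval J *)
Definition relaxable (n n' : tnode V) (J : tint) : Prop :=
  [/\ step I (tn_tis n').2 (tn_tis n).2,
      xlt (next_cost n) (tn_cost n'),
      in_B n (tn_tis n').2 J
    & exists t, tin J t && tin (tn_tis n').1 t].

(* The parts of n' before, inside and after J; only the second one is updated,
   and it is the whole of n' if n' is contained in J. *)
Definition split_node (n n' : tnode V) (J : tint) : seq (tnode V) :=
  let: TNode ((b, e), v') c par u := n' in
  (if b < J.1 then [:: TNode ((b, Some J.1.-1), v') c par u] else [::])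
  ++ TNode ((maxn b J.1, xmin e J.2), v') (next_cost n) (Some (tn_tis n)) u
  :: (if J.2 is Some j then
        if xlt (Some j) e then [:: TNode ((j.+1, e), v') c par u] else [::]
      else [::]).

Inductive relax (n : tnode V) : seq (tnode V) -> seq (tnode V) -> Prop :=
| RelaxDone N : (forall n' J, n' \in N -> ~ relaxable n n' J) -> relax n N N
| RelaxStep N n' J N' : n' \in N -> relaxable n n' J ->
    relax n (split_node n n' J ++ rem n' N) N' -> relax n N N'.

Definition remove_from_U (n : tnode V) : tnode V :=
  TNode (tn_tis n) (tn_cost n) (tn_parent n) false.

(* The sets of nodes that may occur between two removals from U; ties between
   nodes of minimum cost are broken arbitrarily. *)
Inductive tree_run : seq (tnode V) -> Prop :=
| TreeInit (qs : seq (tis V)) : uniq qs ->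
    (forall q, q \in qs <-> is_SI C a q) -> tree_run [seq init_node q | q <- qs]
| TreeStep N n N' : tree_run N -> n \in N -> tn_inU n ->
    (forall m, m \in N -> tn_inU m -> xle (tn_cost n) (tn_cost m)) ->
    relax (remove_from_U n) (remove_from_U n :: rem n N) N' -> tree_run N'.

Definition TIS_tree (N : seq (tnode V)) : Prop :=
  tree_run N /\ (forall n, n \in N -> ~~ tn_inU n).

Definition query_node (N : seq (tnode V)) (t : nat) (v : V) : option (tnode V) :=
  ohead [seq n <- N | ((tn_tis n).2 == v) && tin (tn_tis n).1 t].

Definition query_length (N : seq (tnode V)) (t : nat) (v : V) : xnat :=
  obind (@tn_cost V) (query_node N t v).

(* l lists the vertices met along the parent pointers, after that of n itself *)
Inductive to_seed (N : seq (tnode V)) : tnode V -> seq V -> Prop :=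
| ToSeedDone n : tn_tis n = seed -> to_seed N n [::]
| ToSeedStep n m l : tn_tis n <> seed -> tn_parent n = Some (tn_tis m) ->
    m \in N -> to_seed N m l -> to_seed N n ((tn_tis m).2 :: l).

Definition query_path (N : seq (tnode V)) (t : nat) (v : V) (l : seq V) : Prop :=
  exists2 n, query_node N t v = Some n & to_seed N n l.

End TISTree.

Definition TIS_forest (V : finType) (I : mapf_instance V) C a
    (F : tis V -> seq (tnode V)) : Prop :=
  forall q, is_GSI (I := I) C a q -> TIS_tree C a q (F q).

Section MST.
Context {V : finType} (e : rel V).

(* A shortest walk has no repeated vertex, hence fewer than #|V| edges. *)
Definition dist (u v : V) : xnat :=
  \big[xmin/None]_(n < #|V| |
    [exists p : n.-tuple V, path e u p && (last u p == v)]) Some (n : nat).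

(* In a set T of edges of the complete graph, an edge is given as an ordered
   pair, in one of its two orientations. *)
Definition und (T : {set V * V}) : rel V :=
  [rel x y | ((x, y) \in T) || ((y, x) \in T)].

(* T is connected on S, and acyclic: no edge lies on a cycle, i.e., has its
   ends joined by the other edges. *)
Definition spanning_tree (S : {set V}) (T : {set V * V}) : bool :=
  [&& T \subset setX S S,
      [forall x in S, forall y in S, connect (und T) x y]
    & [forall p in T, ~~ connect (und (T :\ p)) p.1 p.2]].

Definition mst_cost (S : {set V}) : xnat :=
  \big[xmin/None]_(T : {set V * V} | spanning_tree S T)
     \big[xadd/Some 0]_(p in T) dist p.1 p.2.
End MST.

Definition lstate (V : finType) : eqType := ({set V} * tis V)%type.

Record lentry (V : finType) := LEntry {
  le_state : lstate V;
  le_g : nat;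
  le_parent : option (lstate V)
}.

Definition lentry_to_tuple (V : finType) (x : lentry V) :=
  (le_state x, le_g x, le_parent x).
Definition tuple_to_lentry (V : finType)
    (x : lstate V * nat * option (lstate V)) : lentry V :=
  let: (s, g, p) := x in LEntry s g p.
Lemma lentry_to_tupleK (V : finType) :
  cancel (@lentry_to_tuple V) (@tuple_to_lentry V).
Proof. by case. Qed.
HB.instance Definition _ (V : finType) :=
  Equality.copy (lentry V) (can_type (@lentry_to_tupleK V)).

Section LowLevel.
Context {V : finType} (I : mapf_instance V).
Variables (C : seq (constraint I)) (a : 'I_(nb_agents I)).
Variable F : tis V -> seq (tnode V).

Definition h_value (x : lstate V) : xnat :=
  mst_cost (edge I) (x.2.2 |: (goals a :\: x.1)).
Definition f_value (x : lentry V) : xnat :=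
  xadd (Some (le_g x)) (h_value (le_state x)).

Definition transition (x : lstate V) (q : tis V) : Prop :=
  [/\ is_GSI C a q, q.2 \notin x.1
    & goals a :\: x.1 = [set q.2] -> latest_SI C a q.2 q].

Definition successor (x : lentry V) (q : tis V) : option (lentry V) :=
  omap (fun c => LEntry (q.2 |: (le_state x).1, q) (le_g x + c) (Some (le_state x)))
       (query_length (F q) (le_g x) (le_state x).2.2).

Definition push (closed open : seq (lentry V)) (y : lentry V) : seq (lentry V) :=
  if has (fun z => le_state z == le_state y) closed then open
  else if has (fun z => le_state z == le_state y) open then
    [seq if (le_state z == le_state y) && (le_g y < le_g z) then y else z | z <- open]
  else y :: open.

Definition min_f (open : seq (lentry V)) (x : lentry V) : Prop :=
  x \in open /\ (forall y, y \in open -> xle (f_value x) (f_value y)).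

(* The pairs (open set, closed set) that may occur; ties between states of
   minimum f are broken arbitrarily. *)
Inductive astar_run : seq (lentry V) -> seq (lentry V) -> Prop :=
| AstarInit p0 : earliest_SI C a (start a) p0 ->
    astar_run [:: LEntry (set0, p0) 0 None] [::]
| AstarStep open closed x qs : astar_run open closed -> min_f open x ->
    ~~ (goals a \subset (le_state x).1) ->
    (forall q, q \in qs <-> transition (le_state x) q) ->
    astar_run (foldl (push (x :: closed)) (rem x open) (pmap (successor x) qs))
              (x :: closed).

(* the visiting order of the GSIs, from the initial state to x *)
Inductive backtrack (closed : seq (lentry V)) : lentry V -> seq (tis V) -> Prop :=
| BacktrackInit x : le_parent x = None -> backtrack closed x [::]
| BacktrackStep x y qs : le_parent x = Some (le_state y) -> y \in closed ->
    backtrack closed y qs -> backtrack closed x (rcons qs (le_state x).2).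

Inductive concat_paths : nat -> V -> seq (tis V) -> seq V -> Prop :=
| ConcatNil t v : concat_paths t v [::] [::]
| ConcatCons t v q qs l l' : query_path q (F q) t v l ->
    concat_paths (t + size l) q.2 qs l' -> concat_paths t v (q :: qs) (l ++ l').

Inductive astar : option (seq V) -> Prop :=
| AstarSuccess open closed x qs l : astar_run open closed -> min_f open x ->
    goals a \subset (le_state x).1 -> backtrack closed x qs ->
    concat_paths 0 (start a) qs l -> astar (Some l)
| AstarFailure closed : astar_run [::] closed -> astar None.

End LowLevel.

(* [low_level C a r]: under the constraints C, the low-level solver may answer r
   for the agent a; None means that no path is returned. *)
Definition low_level (V : finType) (I : mapf_instance V) C a (r : option (seq V)) :=
  exists2 F, TIS_forest (I := I) C a F & astar C a F r.

Section HighLevel.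
Context {V : finType} (I : mapf_instance V).
Notation agent := 'I_(nb_agents I).

(* Nodes of the constraint tree; their SOC is that of their plan. *)
Definition hnode : eqType := (seq (constraint I) * plan I)%type.

Definition min_soc (open : seq hnode) (N : hnode) : Prop :=
  N \in open /\ (forall M, M \in open -> soc N.2 <= soc M.2).

Definition earliest_conflict (P : plan I) (i j : agent) ci cj : Prop :=
  exists2 t, conflict P i j t ci cj
    & forall i' j' t' ci' cj', conflict P i' j' t' ci' cj' -> t <= t'.

Definition child (N : hnode) (i : agent) (c : constraint I) (r : option (seq V)) :
    seq hnode :=
  if r is Some p then
    [:: (c :: N.1, [ffun b => if b == i then p else N.2 b])]
  else [::].

(* The contents of OPEN that may occur; ties between nodes of minimum SOC, and
   between simultaneous collisions, are broken arbitrarily. *)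
Inductive mgcbs_run : seq hnode -> Prop :=
| MgcbsRoot (P : plan I) : (forall i, low_level [::] i (Some (P i))) ->
    mgcbs_run [:: ([::], P)]
| MgcbsBranch open N i j ci cj ri rj : mgcbs_run open -> min_soc open N ->
    earliest_conflict N.2 i j ci cj ->
    low_level (ci :: N.1) i ri -> low_level (cj :: N.1) j rj ->
    mgcbs_run (child N i ci ri ++ child N j cj rj ++ rem N open).

Definition mgcbs_returns (P : plan I) : Prop :=
  exists open N, [/\ mgcbs_run open, min_soc open N, collision_free N.2 & P = N.2].

End HighLevel.

(* Main.v *)
(* Every constraint-tree node N satisfies two invariants: each of its paths is a
   shortest path of its agent under the constraints of N, and every solution
   respects the constraints of some node of OPEN, since it cannot take both parts
   in one collision. Hence the SOC of a node of minimum SOC is a lower bound.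

   The optimality of the low-level solver combines two Dijkstra arguments. A TIS
   tree is built backwards from its seed, and the nodes removed from U are never
   split again, so that parent pointers stay valid and the cost of a node is the
   shortest time to the seed from any of its instants. In the A* search an earlier
   arrival in a safe interval is never worse, because the agent can wait there; the
   spanning-tree heuristic is consistent, hence closed states carry their earliest
   arrival time. A path of the agent is mapped to a chain of states by collecting
   every goal except its last vertex at its first visit, and the last vertex at the
   end, when it lies in the latest safe interval. *)
From HB Require Import structures.
Require Import Defs.
From mathcomp Require Import all_boot zify.
From Stdlib Require Import Classical_Prop.

Set Implicit Arguments.
Unset Strict Implicit.
Unset Printing Implicit Defensive.

(** * Order on the extended naturals *)

Lemma xle_trans : transitive xle.
Proof. by move=> [y|] [x|] [z|] //=; apply: leq_trans. Qed.

Lemma xle_total : total xle.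
Proof. by move=> [x|] [y|] //=; apply: leq_total. Qed.

Lemma xleNlt x y : xle x y = ~~ xlt y x.
Proof. by rewrite /xlt negbK. Qed.

(** * Safe intervals and TIS trees *)

(** The lower end is the least [b] with [S] true on all of [[b, t]]; the upper end is the
    predecessor of the first failure of [S] after [t], or [None] if [S] never fails there. *)
Lemma max_tint_exists (S : pred nat) t :
  S t -> exists J, max_tint S J /\ tin J t.
Proof.
move=> St; pose lo b := (b <= t) && all S (index_iota b t.+1).
have ex_lo : exists b, lo b.
  by exists t; rewrite /lo leqnn /index_iota subSnn /= St.
case: (ex_minnP ex_lo) => b /andP[le_bt /allP Sb] min_b.
have {}Sb s : b <= s <= t -> S s by move=> ?; apply: Sb; rewrite mem_index_iota; lia.
have lo_ext J' : tin J' t -> (forall s, tin J' s -> S s) -> b <= J'.1.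
  case: J' => b' e' /andP[/= le_b't le_te'] SJ'; apply: min_b; rewrite /lo le_b't.
  apply/allP=> s; rewrite mem_index_iota => ?; apply: SJ'.
  by move: le_te'; rewrite /tin /=; case: e' => [e'|]; rewrite /=; lia.
have [[u /andP[lt_tu nSu]]|allS] := classic (exists u, (t < u) && ~~ S u).
  have ex_u : exists u, (t < u) && ~~ S u by exists u; rewrite lt_tu.
  case: (ex_minnP ex_u) => {nSu lt_tu}u /andP[lt_tu nSu] min_u.
  exists (b, Some u.-1); split; last by rewrite /tin /=; lia.
  split; first by rewrite /tint_nonempty /=; lia.
    move=> s /andP[/= le_bs le_su]; have [le_st|lt_ts] := leqP s t.
      by apply: Sb; lia.
    by apply: contraT => nSs; have := min_u s; rewrite lt_ts nSs => /(_ isT); lia.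
  move=> [b' e'] _ SJ' subJ'.
  have tJ' : tin (b', e') t by apply: subJ'; rewrite /tin /=; lia.
  have := lo_ext _ tJ' SJ'; rewrite /= => le_bb'.
  have : tin (b', e') b by apply: subJ'; rewrite /tin /=; lia.
  have : tin (b', e') u.-1 by apply: subJ'; rewrite /tin /=; lia.
  have : ~~ tin (b', e') u by apply: contra nSu => /SJ'.
  rewrite /tin /=; case: e' {SJ' subJ' tJ'} => [e'|] /=; last by lia.
  by move=> ? ? ?; congr (_, Some _); lia.
have {}allS s : b <= s -> S s.
  move=> le_bs; have [le_st|lt_ts] := leqP s t; first by apply: Sb; lia.
  by apply: contraT => nSs; case: allS; exists s; rewrite lt_ts.
exists (b, None); split; last by rewrite /tin /= le_bt.
split=> //; first by move=> s /andP[/= /allS].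
move=> [b' e'] _ SJ' subJ'.
have tJ' : tin (b', e') t by apply: subJ'; rewrite /tin /= le_bt.
have := lo_ext _ tJ' SJ'; rewrite /= => le_bb'.
have : tin (b', e') b by apply: subJ'; rewrite /tin /= leqnn.
case: e' {SJ' tJ'} subJ' => [e'|] subJ'; rewrite /tin /=.
  (* A finite end [e'] is refuted by [b + e'.+1], which lies in the unbounded interval. *)
  by have := subJ' (b + e'.+1); rewrite /tin /= leq_addr => /(_ isT); lia.
by move=> ?; congr (_, _); lia.
Qed.

(** The union of two overlapping intervals is an interval and still lies in [S], so by maximality
    both are equal to it. *)
Lemma max_tint_unique (S : pred nat) J1 J2 t :
  max_tint S J1 -> max_tint S J2 -> tin J1 t -> tin J2 t -> J1 = J2.
Proof.
move=> [ne1 S1 m1] [ne2 S2 m2] t1 t2.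
pose J := (minn J1.1 J2.1, if xle J1.2 J2.2 then J2.2 else J1.2) : tint.
have JE s : tin J s = tin J1 s || tin J2 s.
  case: J1 J2 t1 t2 {ne1 S1 m1 ne2 S2 m2} @J => [b1 e1] [b2 e2].
  by rewrite /tin /=; case: e1 e2 => [e1|] [e2|] /=; try case: ifP => /=; lia.
have neJ : tint_nonempty J.
  have : tin J t by rewrite JE t1.
  by rewrite /tin /tint_nonempty; case: (J.2) => //= e; lia.
have SJ s : tin J s -> S s by rewrite JE => /orP[/S1|/S2].
rewrite -[LHS](m1 J) -1?[RHS](m2 J) // => s; rewrite JE => ->; by rewrite ?orbT.
Qed.

Definition covers (V : finType) (t : nat) (v : V) (n : tnode V) : bool :=
  ((tn_tis n).2 == v) && tin (tn_tis n).1 t.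

(** * Splitting a node along an interval *)

Section SplitNode.
Variables (V : finType) (n n' : tnode V) (J : tint).
Hypothesis meetJ : exists t, tin J t && tin (tn_tis n').1 t.

(** As [J] meets the interval of [n'], the pieces partition that interval. *)
Lemma count_split_node t v :
  count (covers t v) (split_node n n' J) = covers t v n'.
Proof.
case: n' meetJ => [[[b e] w] c par u] [s] /=.
rewrite count_cat /= /covers; case: J => [j1 j2] /=.
case: j2 e => [j2|] [e|] /=; rewrite /xmin /xlt /tin /=;
  do ?[case: ifP => /= ?]; case: (w == v) => /=; lia.
Qed.

Lemma split_nodeP x : x \in split_node n n' J ->
  [/\ (tn_tis x).2 = (tn_tis n').2, tn_inU x = tn_inU n',
      tint_nonempty (tn_tis x).1,
      forall t, tin (tn_tis x).1 t -> tin (tn_tis n').1 t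
    & tn_cost x = tn_cost n' /\ tn_parent x = tn_parent n' \/
      [/\ tn_cost x = next_cost n, tn_parent x = Some (tn_tis n)
        & forall t, tin (tn_tis x).1 t -> tin J t]].
Proof.
case: n' meetJ => [[[b e] w] c par u] [s] /=; case: J => [j1 j2] /=.
rewrite /tin /= mem_cat inE => meet /or3P[].
- case: ifP => //= lt_bj; rewrite inE => /eqP-> /=; split=> //; last by left.
    by rewrite /tint_nonempty /=; lia.
  by move=> t; case: e meet => [e|] /=; case: j2 => [j2|] /=; lia.
- move=> /eqP-> /=; split=> //; last right; rewrite ?/tint_nonempty /xmin /=.
  + by case: j2 e meet => [j2|] [e|] /=; try case: ifP => /=; lia.
  + by move=> t; case: j2 e meet => [j2|] [e|] /=; try case: ifP => /=; lia.
  split=> // t; case: j2 e meet => [j2|] [e|] /=; try case: ifP => /=; lia.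
case: j2 meet => [j2|] //= meet; case: ifP => //= lt_je.
rewrite inE => /eqP-> /=; split=> //; last by left.
  by move: lt_je; rewrite /tint_nonempty /xlt; case: (e) => [e'|] /=; lia.
by move=> t; case: e meet lt_je => [e|] /=; lia.
Qed.

End SplitNode.

(** * Dijkstra invariants of the tree construction *)

Section Tree.
Variables (V : finType) (I : mapf_instance V) (C : seq (constraint I)).
Variables (a : 'I_(nb_agents I)) (seed : tis V).

Definition move_allowed t u v : bool :=
  step I u v && (edge_constraint a t u v \notin C).

(* The count expresses at once that nodes are safe, disjoint and exhaustive. *)
Definition tiling (N : seq (tnode V)) : Prop :=
  (forall t v, count (covers t v) N = safe C a t v) /\
  (forall n, n \in N -> tint_nonempty (tn_tis n).1).

(** Two distinct nodes would bring the count to at least 2, whereas it is the boolean [safe]. *)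
Lemma tiling_inj N n m t v : tiling N ->
  n \in N -> m \in N -> covers t v n -> covers t v m -> n = m.
Proof.
move=> [cN _] nN mN cn cm; have /permP pN := perm_to_rem nN.
have := mN; rewrite (perm_mem (perm_to_rem nN)) inE => /predU1P[//|m_rem].
have := cN t v; rewrite pN /= cn.
have : 0 < count (covers t v) (rem n N) by rewrite -has_count; apply/hasP; exists m.
by case: safe => /=; lia.
Qed.

Lemma nonempty_covers (n : tnode V) :
  tint_nonempty (tn_tis n).1 -> covers (tn_tis n).1.1 (tn_tis n).2 n.
Proof. by rewrite /covers /tin /tint_nonempty eqxx leqnn => ->. Qed.

Lemma tiling_tis_inj N n m : tiling N ->
  n \in N -> m \in N -> tn_tis n = tn_tis m -> n = m.
Proof.
move=> tN nN mN eq_tis; have ne := tN.2 n nN.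
apply: (tiling_inj tN nN mN (nonempty_covers ne)).
by rewrite eq_tis nonempty_covers // -eq_tis.
Qed.

Lemma tiling_rem N n : tiling N -> n \in N -> n \notin rem n N.
Proof.
move=> [cN ne] nN; apply/negP=> n_rem; have /permP pN := perm_to_rem nN.
have cn := nonempty_covers (ne _ nN).
have := cN (tn_tis n).1.1 (tn_tis n).2; rewrite pN /= cn.
have : 0 < count (covers (tn_tis n).1.1 (tn_tis n).2) (rem n N).
  by rewrite -has_count; apply/hasP; exists n.
by case: safe => /=; lia.
Qed.

Lemma tiling_query N n t v : tiling N -> n \in N -> covers t v n ->
  query_node N t v = Some n.
Proof.
move=> tN nN cn; rewrite /query_node -/(covers t v).
have : n \in filter (covers t v) N by rewrite mem_filter cn.
case def_s: (filter _ N) => [//|m s] _ /=; congr Some.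
have : m \in filter (covers t v) N by rewrite def_s mem_head.
by rewrite mem_filter => /andP[cm mN]; apply: (tiling_inj tN mN nN cm cn).
Qed.

Lemma query_node_covers (N : seq (tnode V)) n t v :
  query_node N t v = Some n -> n \in N /\ covers t v n.
Proof.
rewrite /query_node -/(covers t v).
case def_s: (filter _ N) => [//|m s] /= [<-].
have : m \in filter (covers t v) N by rewrite def_s mem_head.
by rewrite mem_filter => /andP[].
Qed.

(** The parent is required to be outside [U]: such nodes are never split, so the TIS state stored in
    the pointer remains that of a node. *)
Definition parent_ok (N : seq (tnode V)) (n : tnode V) : Prop :=
  forall c, tn_cost n = Some c ->
    c = 0 /\ tn_tis n = seed \/
    exists m, [/\ m \in N, ~~ tn_inU m, tn_parent n = Some (tn_tis m),
      tn_cost m = Some c.-1 & [/\ 0 < c, step I (tn_tis n).2 (tn_tis m).2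
      & forall t, tin (tn_tis n).1 t -> tin (tn_tis m).1 t.+1]].

Definition has_seed (N : seq (tnode V)) : Prop :=
  exists s, [/\ s \in N, tn_tis s = seed & tn_cost s = Some 0].

Definition relaxed (N : seq (tnode V)) (m : tnode V) : Prop :=
  forall n t, n \in N -> tin (tn_tis n).1 t -> tin (tn_tis m).1 t.+1 ->
    move_allowed t (tn_tis n).2 (tn_tis m).2 ->
    xle (tn_cost n) (next_cost m).

Record tree_inv (N : seq (tnode V)) : Prop := TreeInv {
  ti_tiling : tiling N;
  ti_seed : has_seed N;
  ti_parent : forall n, n \in N -> parent_ok N n;
  ti_mono : forall m u, m \in N -> u \in N -> ~~ tn_inU m -> tn_inU u ->
              xle (tn_cost m) (tn_cost u);
  ti_relaxed : forall m, m \in N -> ~~ tn_inU m -> relaxed N m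
}.

(** The invariant inside the relaxation loop of [n], which has just left [U]: its cost separates the
    closed nodes from those in [U], and it is the only closed node that may still violate
    [relaxed]. *)
Record relax_inv (n : tnode V) (N : seq (tnode V)) : Prop := RelaxInv {
  ri_tiling : tiling N;
  ri_seed : has_seed N;
  ri_parent : forall m, m \in N -> parent_ok N m;
  ri_mem : n \in N;
  ri_closed : ~~ tn_inU n;
  ri_below : forall m, m \in N -> ~~ tn_inU m -> xle (tn_cost m) (tn_cost n);
  ri_above : forall u, u \in N -> tn_inU u -> xle (tn_cost n) (tn_cost u);
  ri_relaxed : forall m, m \in N -> ~~ tn_inU m -> m <> n -> relaxed N m
}.

Lemma xle_next (n : tnode V) : xle (tn_cost n) (next_cost n).
Proof. by rewrite /next_cost; case: tn_cost => //= c; lia. Qed.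

(** A relaxable node costs more than [next_cost n], while closed nodes cost at most as much as [n];
    hence only nodes of [U] are split, and every closed node survives unchanged. *)
Lemma relax_inv_step n N n' J : n' \in N -> relaxable C a n n' J ->
  relax_inv n N -> relax_inv n (split_node n n' J ++ rem n' N).
Proof.
move=> n'N [step_n' lt_cost maxJ meetJ] iN.
have tN := ri_tiling iN.
have n'U : tn_inU n'.
  apply: contraLR lt_cost => n'U; rewrite -xleNlt.
  exact: xle_trans (ri_below iN n'N n'U) (xle_next n).
have memN' x : (x \in split_node n n' J ++ rem n' N) =
               (x \in split_node n n' J) || (x \in rem n' N) by rewrite mem_cat.
have remN x : x \in rem n' N -> x \in N by apply: mem_rem.
have keepN x : x \in N -> x <> n' -> x \in split_node n n' J ++ rem n' N.
  move=> xN ne_x; rewrite memN' orbC; apply/orP; left.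
  by move: xN; rewrite (perm_mem (perm_to_rem n'N)) inE => /predU1P[].
have closedN x : x \in N -> ~~ tn_inU x -> x \in split_node n n' J ++ rem n' N.
  by move=> xN xU; apply: keepN => // eq_x; rewrite eq_x n'U in xU.
have closedN' x : x \in split_node n n' J ++ rem n' N -> ~~ tn_inU x -> x \in N.
  by rewrite memN' => /orP[/(split_nodeP meetJ)[_ -> _ _ _]|/remN//]; rewrite n'U.
have parent_closed x : parent_ok N x -> parent_ok (split_node n n' J ++ rem n' N) x.
  move=> px c /px[|[m [mN mU ? ? ?]]]; [by left | right].
  by exists m; split=> //; apply: closedN.
split.
- split=> [t v|x]; last first.
    by rewrite memN' => /orP[/(split_nodeP meetJ)[]//|/remN]; apply: tN.2.
  rewrite count_cat count_split_node // -tN.1.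
  by have /permP-> := perm_to_rem n'N.
(* The seed has cost 0, which no [next_cost] undercuts, so it is not split. *)
- have [s [sN s_seed s_cost]] := ri_seed iN; exists s; split=> //.
  apply: keepN => // eq_s; move: lt_cost; rewrite -eq_s s_cost /xlt.
  by rewrite /next_cost; case: tn_cost.
- move=> x; rewrite memN' => /orP[xs|/remN xN]; last first.
    exact: (parent_closed x (ri_parent iN xN)).
  have [x_v xU ne_x sub_x] := split_nodeP meetJ xs.
  case=> [[x_cost x_par]|[x_cost x_par subJ]] c.
    rewrite x_cost => n'_cost; right.
    case: (parent_closed n' (ri_parent iN n'N) c n'_cost) => [[c0 n'_seed]|].
      by move: lt_cost; rewrite n'_cost c0 /xlt /next_cost; case: tn_cost.
    case=> m [mN mU m_par m_cost [c_gt0 n'_step n'_in]].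
    exists m; split=> //; first by rewrite x_par.
    by rewrite x_v; split=> // t /sub_x/n'_in.
  rewrite x_cost /next_cost; case n_cost: (tn_cost n) => [d|] //= [<-].
  right; exists n; split=> //; first exact: closedN (ri_mem iN) (ri_closed iN).
    exact: ri_closed iN.
  split=> //; first by rewrite x_v.
  by case: maxJ => _ SJ _ t /subJ/SJ/and3P[].
- exact: closedN (ri_mem iN) (ri_closed iN).
- exact: ri_closed iN.
- by move=> m mN' mU; apply: (ri_below iN (closedN' m mN' mU) mU).
- move=> u; rewrite memN' => /orP[us|/remN uN uU]; last exact: ri_above iN _ uN uU.
  have [_ _ _ _] := split_nodeP meetJ us.
  case=> [[-> _]|[-> _ _]] _; last exact: xle_next.
  exact: (ri_above iN n'N n'U).
move=> m mN' mU ne_m x t xN' tx tm mv.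
have rel_m := ri_relaxed iN (closedN' m mN' mU) mU ne_m.
move: xN'; rewrite memN' => /orP[xs|/remN xN]; last exact: rel_m tx tm mv.
have [x_v _ _ sub_x] := split_nodeP meetJ xs.
rewrite x_v in mv; have le_n'm := rel_m _ _ n'N (sub_x _ tx) tm mv.
case=> [[-> _]//|[-> _ _]]; apply: xle_trans le_n'm.
by case/orP: (xle_total (next_cost n) (tn_cost n')) => //; rewrite xleNlt lt_cost.
Qed.

(** When the loop ends, [n] satisfies [relaxed] too: a violating move at time [t] would lie in some
    interval of [B], and its origin would still be relaxable. *)
Lemma relax_tree_inv n N N' : relax C a n N N' -> relax_inv n N -> tree_inv N'.
Proof.
elim=> {N N'} [N doneN|N n' J N' n'N rel _ IH] iN; last first.
  exact/IH/relax_inv_step.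
split.
- exact: ri_tiling iN.
- exact: ri_seed iN.
- exact: ri_parent iN.
- move=> m u mN uN mU uU.
  exact: xle_trans (ri_below iN mN mU) (ri_above iN uN uU).
move=> m mN mU; have [->|ne_m] := eqVneq m n; last exact/(ri_relaxed iN)/eqP.
move=> x t xN tx tn /andP[step_xn ok_xn]; rewrite xleNlt; apply/negP=> lt_x.
have safe_x : safe C a t (tn_tis x).2.
  have : 0 < count (covers t (tn_tis x).2) N.
    by rewrite -has_count; apply/hasP; exists x => //; rewrite /covers eqxx.
  by rewrite (ri_tiling iN).1; case: safe.
have [|J [maxJ tJ]] := @max_tint_exists (fun t => [&& safe C a t (tn_tis x).2,
    tin (tn_tis n).1 t.+1 & edge_constraint a t (tn_tis x).2 (tn_tis n).2 \notin C]) t.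
  by rewrite safe_x tn.
by apply: (doneN x J xN); split=> //; exists t; rewrite tJ.
Qed.

Lemma covers_remove_from_U t v (n : tnode V) :
  covers t v (remove_from_U n) = covers t v n.
Proof. by []. Qed.

Lemma tree_run_inv N : is_SI C a seed -> tree_run C a seed N -> tree_inv N.
Proof.
move=> seedSI; elim=> {N} [qs uniq_qs qsP|N n N' _ iN nN nU min_n rel].
  have memI n : n \in [seq init_node seed q | q <- qs] ->
      exists2 q, is_SI C a q & n = init_node seed q.
    by case/mapP=> q /qsP ? ->; exists q.
  split.
  - split=> [t v|n /memI[q [? _ _] ->]//].
    rewrite count_map; case safe_tv: safe.
      (* The SI around [t] at [v] is unique and occurs once in [qs], so counting the covering nodes
         amounts to counting that SI. *)
      have [J [maxJ tJ]] := max_tint_exists (S := safe C a ^~ v) safe_tv.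
      have Jqs : (J, v) \in qs by apply/qsP.
      transitivity (count_mem (J, v) qs); last by rewrite count_uniq_mem // Jqs.
      apply: eq_in_count => -[J' w] /qsP; rewrite /is_SI /= => maxJ'; rewrite /covers /=.
      apply/andP/eqP => [[/eqP def_w tJ']|[-> ->]]; last by rewrite eqxx.
      rewrite def_w in maxJ' *; congr (_, _).
      exact: max_tint_unique maxJ' maxJ tJ' tJ.
    apply/eqP; rewrite -leqn0 leqNgt -has_count; apply/hasPn=> q /qsP[_ Sq _].
    by apply/negP=> /andP[/= /eqP def_v /Sq]; rewrite def_v safe_tv.
  - exists (init_node seed seed); rewrite /= eqxx; split=> //.
    by apply: map_f; apply/qsP.
  - move=> n /memI[q _ ->] c /=; case: eqP => // -> [<-]; by left.
  - by move=> m u /memI[q _ ->].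
  by move=> m /memI[q _ ->].
have tN := ti_tiling iN; have n_rem := tiling_rem tN nN.
have remN x : x \in rem n N -> x \in N by apply: mem_rem.
have closedN x : x \in N -> ~~ tn_inU x -> x \in rem n N.
  move=> xN; rewrite (perm_mem (perm_to_rem nN)) inE in xN.
  by case/predU1P: xN => // ->; rewrite nU.
have parent_closed x : parent_ok N x -> parent_ok (remove_from_U n :: rem n N) x.
  move=> px c /px[|[m [mN mU ? ? ?]]]; [by left | right].
  by exists m; split=> //; rewrite inE closedN ?orbT.
apply: relax_tree_inv rel _; split.
- split=> [t v|x].
    by rewrite /= covers_remove_from_U -tN.1; have /permP-> := perm_to_rem nN.
  by rewrite inE => /predU1P[->|/remN]; [apply: (tN.2 n) | apply: tN.2].
- have [s [sN s_seed s_cost]] := ti_seed iN.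
  move: sN; rewrite (perm_mem (perm_to_rem nN)) inE => /predU1P[def_s|s_rem].
    by exists (remove_from_U n); rewrite -def_s mem_head.
  by exists s; rewrite inE s_rem orbT.
- move=> x; rewrite inE => /predU1P[->|/remN xN].
    exact: (parent_closed n (ti_parent iN nN)).
  exact: (parent_closed x (ti_parent iN xN)).
- exact: mem_head.
- by [].
- move=> m; rewrite inE => /predU1P[->|/remN mN] mU; last exact: ti_mono iN _ _ _ _ mU nU.
  by rewrite /=; case: tn_cost => //=.
- by move=> u; rewrite inE => /predU1P[->|/remN uN] //=; apply: min_n.
move=> m; rewrite inE => /predU1P[->//|/remN mN] mU _ x t xN' tx tm mv.
move: xN'; rewrite inE => /predU1P[def_x|/remN xN]; last first.
  exact: (ti_relaxed iN mN mU xN tx tm mv).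
by rewrite def_x in tx mv *; apply: (ti_relaxed iN mN mU nN tx tm mv).
Qed.

(** * Queries on a completed tree *)

Definition walk_allowed (w : nat -> V) (t t' : nat) : Prop :=
  (forall s, t <= s <= t' -> safe C a s (w s)) /\
  (forall s, t <= s < t' -> move_allowed s (w s) (w s.+1)).

Variable N : seq (tnode V).
Hypotheses (seedSI : is_SI C a seed) (treeN : TIS_tree C a seed N).

Let invN : tree_inv N.
Proof. by case: treeN => run _; apply: tree_run_inv. Qed.

(** With [U] empty, every node is [relaxed]. By induction on [k], starting from the seed of cost 0,
    each step backwards along the walk raises the cost by at most one. *)
Lemma query_length_le w t k : walk_allowed w t (t + k) ->
  w (t + k) = seed.2 -> tin seed.1 (t + k) ->
  exists2 c, query_length N t (w t) = Some c & c <= k.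
Proof.
have closedN : forall n, n \in N -> ~~ tn_inU n by case: treeN.
have tN := ti_tiling invN.
elim: k t => [|k IH] t [safe_w move_w] w_seed in_seed.
  rewrite addn0 in w_seed in_seed; have [s [sN s_seed s_cost]] := ti_seed invN.
  exists 0 => //; rewrite /query_length (tiling_query tN sN) //.
  by rewrite /covers s_seed w_seed eqxx.
rewrite -addSnnS in w_seed in_seed safe_w move_w.
have [|c] := IH t.+1 _ w_seed in_seed.
  by split=> s ?; [apply: safe_w | apply: move_w]; lia.
rewrite /query_length; case q_m: query_node => [m|] //= m_cost le_ck.
have [mN /andP[/eqP m_v m_t]] := query_node_covers q_m.
have safe_t : safe C a t (w t) by apply: safe_w; lia.
have : 0 < count (covers t (w t)) N by rewrite tN.1 safe_t.
rewrite -has_count => /hasP[n nN n_cov]; rewrite (tiling_query tN nN n_cov) /=.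
have /andP[/eqP n_v n_t] := n_cov.
have := ti_relaxed invN mN (closedN m mN) nN n_t m_t.
rewrite n_v m_v /next_cost m_cost => /(_ (move_w _ _)) le_n.
have /le_n {le_n} : t <= t < t.+1 + k by lia.
by case: tn_cost => //= d le_d; exists d => //; lia.
Qed.

Lemma parent_okP n c : n \in N -> tn_cost n = Some c ->
  c = 0 /\ tn_tis n = seed \/
  exists m d, [/\ m \in N, tn_parent n = Some (tn_tis m), c = d.+1,
    tn_cost m = Some d & step I (tn_tis n).2 (tn_tis m).2 /\
    forall t, tin (tn_tis n).1 t -> tin (tn_tis m).1 t.+1].
Proof.
move=> nN n_cost; have [|[m [mN _ ? ? [c_gt0 ? ?]]]] := ti_parent invN nN n_cost.
  by left.
by right; exists m, c.-1; split=> //; rewrite prednK.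
Qed.

(** Each parent pointer shifts the instant by one while staying inside the interval of the node
    reached. *)
Lemma query_length_tin t v c : query_length N t v = Some c -> tin seed.1 (t + c).
Proof.
rewrite /query_length; case q_n: query_node => [n|] //=.
have {q_n} [nN /andP[_ n_t]] := query_node_covers q_n.
elim: c t n nN n_t => [|c IH] t n nN n_t n_cost;
  have [[c0 n_seed]|[m [d [mN _ // [<-] m_cost [_ m_in]]]]] := parent_okP nN n_cost => //.
  by rewrite addn0 -n_seed.
by rewrite -addSnnS; apply: IH mN (m_in _ n_t) m_cost.
Qed.

(** The cost drops by one at each pointer and is 0 at the seed; TIS states identify nodes, so
    pointers are unambiguous. *)
Lemma query_pathP t v c l : query_length N t v = Some c -> query_path seed N t v l ->
  [/\ size l = c, path (step I) v l & last v l = seed.2].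
Proof.
rewrite /query_length => q_len [n q_n n_l]; rewrite q_n /= in q_len.
have {q_n} [nN /andP[/eqP <- _]] := query_node_covers q_n.
have tN := ti_tiling invN.
elim: n_l c nN q_len => {n l} [n n_seed|n m l n_nseed n_par mN _ IH] c nN n_cost.
  have [s [sN s_seed s_cost]] := ti_seed invN.
  have def_n := tiling_tis_inj tN nN sN (etrans n_seed (esym s_seed)).
  by move: n_cost; rewrite def_n s_cost => -[<-]; rewrite s_seed.
have [[_ /n_nseed]//|[m' [d [m'N m'_par -> m'_cost [m'_step _]]]]] := parent_okP nN n_cost.
move: n_par; rewrite m'_par => -[/(tiling_tis_inj tN m'N mN) def_m].
rewrite def_m in m'_cost m'_step; have [<- l_path l_last] := IH _ mN m'_cost.
by rewrite /= m'_step.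
Qed.

End Tree.

(** * The spanning-tree heuristic *)

Lemma xmin_Some x y : xmin (Some x) (Some y) = Some (minn x y).
Proof. by rewrite /xmin /= /minn; case: ltngtP => // ->. Qed.

Lemma xminA : associative xmin.
Proof. by move=> [x|] [y|] [z|]; rewrite ?xmin_Some ?minnA. Qed.

Lemma xminC : commutative xmin.
Proof. by move=> [x|] [y|]; rewrite ?xmin_Some 1?minnC. Qed.

Lemma xmin_None : left_id None xmin.
Proof. by case. Qed.

(** The monoid structures let [bigD1] and [big_setU1] isolate a term in the minima and sums that
    define [dist] and [mst_cost]. *)
HB.instance Definition _ := Monoid.isComLaw.Build xnat None xmin xminA xminC xmin_None.

Lemma xaddA : associative xadd.
Proof. by move=> [x|] [y|] [z|] //=; rewrite addnA. Qed.

Lemma xaddC : commutative xadd.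
Proof. by move=> [x|] [y|] //=; rewrite addnC. Qed.

Lemma xadd0 : left_id (Some 0) xadd.
Proof. by case. Qed.

HB.instance Definition _ := Monoid.isComLaw.Build xnat (Some 0) xadd xaddA xaddC xadd0.

Lemma xle_addl x y : xle y (xadd x y).
Proof. by case: x y => [x|] [y|] //=; rewrite leq_addl. Qed.

Lemma xle_add2r x y z : xle x y -> xle (xadd x z) (xadd y z).
Proof. by case: x y z => [x|] [y|] [z|] //=; rewrite leq_add2r. Qed.

Lemma xle_bigmin (T : finType) (P : pred T) (F : T -> xnat) i :
  P i -> xle (\big[xmin/None]_(j | P j) F j) (F i).
Proof.
move=> Pi; rewrite (bigD1 i Pi) /= /xmin; case: ifP => [_|]; last first.
  by case/orP: (xle_total (F i) (\big[xmin/None]_(j | P j && (j != i)) F j)) => ->.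
by case: (F i) => /=.
Qed.

Lemma bigmin_attained (T : finType) (P : pred T) (F : T -> xnat) :
  \big[xmin/None]_(j | P j) F j = None \/
  exists2 i, P i & \big[xmin/None]_(j | P j) F j = F i.
Proof.
apply: (big_ind (fun x => x = None \/ exists2 i, P i & x = F i)); first by left.
  by move=> x y Hx Hy; rewrite /xmin; case: ifP.
by move=> i Pi; right; exists i.
Qed.

(** Dropping the waits and shortcutting repetitions leaves a path with fewer than [#|V|] edges,
    which is the range of lengths over which [dist] minimises. *)
Lemma dist_le_walk (V : finType) (I : mapf_instance V) (w : nat -> V) t k :
  (forall s, t <= s < t + k -> step I (w s) (w s.+1)) ->
  xle (dist (edge I) (w t) (w (t + k))) (Some k).
Proof.
move=> w_step.
have [p p_path [p_last p_size]] : exists2 p, path (edge I) (w t) p &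
    last (w t) p = w (t + k) /\ size p <= k.
  elim: k t w_step => [|k IH] t w_step; first by exists [::]; rewrite ?addn0.
  have [|p p_path [p_last p_size]] := IH t.+1; first by move=> s ?; apply: w_step; lia.
  rewrite addSnnS in p_last.
  have /orP[/eqP eq_w|edge_w] : step I (w t) (w t.+1) by apply: w_step; lia.
    by exists p; rewrite eq_w //; split=> //; lia.
  by exists (w t.+1 :: p) => //=; rewrite edge_w.
case/shortenP: p_path p_last => q q_path q_uniq sub_qp q_last.
have q_size : size q <= k.
  by apply: leq_trans p_size; apply: uniq_leq_size => //; case/andP: q_uniq.
have lt_q : size q < #|V|.
  by rewrite -[(size q).+1](card_uniqP q_uniq) max_card.
pose P (n : 'I_#|V|) :=
  [exists p : n.-tuple V, path (edge I) (w t) p && (last (w t) p == w (t + k))].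
have Pq : P (Ordinal lt_q).
  by apply/existsP; exists (in_tuple q); rewrite /= q_path q_last eqxx.
apply: (@xle_trans (Some (size q))) => //.
exact: (xle_bigmin (fun n : 'I_#|V| => Some (n : nat)) Pq).
Qed.

Lemma connect_homo (T T' : finType) (e : rel T) (e' : rel T') (f : T -> T') :
  (forall x y, e x y -> connect e' (f x) (f y)) ->
  forall x y, connect e x y -> connect e' (f x) (f y).
Proof.
move=> f_e x y /connectP[p]; elim: p x => [|z p IH] x /=; first by move=> _ ->.
by move=> /andP[/f_e xz /IH zy] /zy; apply: connect_trans.
Qed.

Section SpanningTree.
Variables (V : finType) (v q : V) (S : {set V}) (T : {set V * V}).
Hypotheses (vS : v \notin S) (qS : q \in S) (treeT : spanning_tree S T).

Let sub_TS x y : (x, y) \in T -> x \in S /\ y \in S.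
Proof. by case/and3P: treeT => /subsetP sub _ _ /sub/setXP. Qed.

Let newT : (v, q) \notin T.
Proof. by apply: contra vS => /sub_TS[]. Qed.

Lemma und_sym (E : {set V * V}) : symmetric (und E).
Proof. by move=> x y; rewrite /und /= orbC. Qed.

Lemma spanning_tree_leaf : spanning_tree (v |: S) ((v, q) |: T).
Proof.
have [/subsetP sub /forall_inP conn /forall_inP acyc] := and3P treeT.
apply/and3P; split.
- apply/subsetP=> -[x y]; rewrite !inE => /predU1P[[-> ->]|/sub_TS[-> ->]].
    by rewrite eqxx qS orbT.
  by rewrite !orbT.
- have csym := sym_connect_sym (und_sym ((v, q) |: T)).
  suff conn_q x : x \in v |: S -> connect (und ((v, q) |: T)) q x.
    apply/forall_inP=> x xS; apply/forall_inP=> y yS.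
    by apply: connect_trans (conn_q _ yS); rewrite csym conn_q.
  move=> /setU1P[->|xS].
    by apply: connect1; rewrite /und /= !inE eqxx orbT.
  have /forall_inP/(_ _ xS) := conn _ qS; apply: connect_sub => y z yz.
  by apply: connect1; move: yz; rewrite /und /= !inE => /orP[] ->; rewrite !orbT.
apply/forall_inP=> -[x y]; move=> /setU1P[[-> ->]|xyT] /=.
  (* No edge of [T] meets [v], so only the new edge can join [v] to [q]. *)
  rewrite setU1K //; apply/connectP=> -[[|z p] /=].
    by move=> _ qv; move: vS; rewrite -qv qS.
  by move=> /andP[/orP[]/sub_TS[? ?] _ _]; case/negP: vS.
apply: contra (acyc _ xyT) => /=.
have [xS yS] := sub_TS xyT.
have neq_v z : z \in S -> (z == v) = false.
  by move=> zS; apply: contraNF vS => /eqP<-.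
(* The contraction of the leaf [v] onto [q] turns a path through the new edge into one within
   [T]. *)
pose f z := if z == v then q else z.
have -> : connect (und (T :\ (x, y))) x y = connect (und (T :\ (x, y))) (f x) (f y).
  by rewrite /f !neq_v.
apply: connect_homo => z t; rewrite /und /= !inE.
have fvq : connect (und (T :\ (x, y))) (f v) (f q) by rewrite /f eqxx neq_v.
have fT z' t' : (z', t') != (x, y) -> (z', t') \in T -> und (T :\ (x, y)) (f z') (f t').
  by move=> ne zt; have [zS tS] := sub_TS zt; rewrite /f !neq_v // /und /= !inE ne zt.
case/orP=> /andP[ne /predU1P[[-> ->]|zt]] //; first exact/connect1/fT.
  by rewrite (sym_connect_sym (und_sym _)).
by rewrite (sym_connect_sym (und_sym _)); apply/connect1/fT.
Qed.

End SpanningTree.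

(** A new vertex [v] is hung as a leaf on [q] in an optimal tree of [S]. This is the inequality
    behind the consistency of the heuristic. *)
Lemma mst_cost_setU1 (V : finType) (e : rel V) v q (S : {set V}) : q \in S ->
  xle (mst_cost e (v |: S)) (xadd (dist e v q) (mst_cost e S)).
Proof.
move=> qS; have [vS|vS] := boolP (v \in S).
  by rewrite (setUidPr _) ?sub1set // xle_addl.
pose cost (T : {set V * V}) := \big[xadd/Some 0]_(p in T) dist e p.1 p.2.
rewrite /mst_cost -/cost.
have [->|[T treeT ->]] := bigmin_attained (spanning_tree S) cost.
  by case: dist.
apply: xle_trans (xle_bigmin cost (spanning_tree_leaf vS qS treeT)) _.
rewrite /cost big_setU1 //=; last first.
  case/and3P: treeT => /subsetP sub _ _; apply: contra vS.
  by move/sub/setXP=> [].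
by case: xadd => //=.
Qed.

Lemma mst_cost_set1 (V : finType) (e : rel V) v : mst_cost e [set v] = Some 0.
Proof.
have tree0 : spanning_tree [set v] set0.
  apply/and3P; split; rewrite ?sub0set //; last by apply/forall_inP=> p; rewrite inE.
  by apply/forall_inP=> x /set1P->; apply/forall_inP=> y /set1P->; apply: connect0.
have := xle_bigmin (fun T : {set V * V} =>
  \big[xadd/Some 0]_(p in T) dist e p.1 p.2) tree0.
rewrite -/(mst_cost e [set v]) big_set0.
by case: mst_cost => //= c; rewrite leqn0 => /eqP->.
Qed.

(** * The low-level search *)

Section Push.
Variable V : finType.
Implicit Types (open closed s : seq (lentry V)) (x y z : lentry V).

Lemma mem_push closed open y z : z \in push closed open y -> z \in open \/ z = y.
Proof.
rewrite /push; case: ifP => _; first by left.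
case: ifP => _; last by rewrite inE => /predU1P[]; [right | left].
by case/mapP=> x xO ->; case: ifP; [right | left].
Qed.

Lemma push_keep closed open y z : z \in open ->
  exists2 z', z' \in push closed open y & le_state z' = le_state z /\ le_g z' <= le_g z.
Proof.
move=> zO; rewrite /push; case: ifP => _; first by exists z.
case: ifP => _; last by exists z; rewrite // inE zO orbT.
exists (if (le_state z == le_state y) && (le_g y < le_g z) then y else z).
  exact: map_f zO.
by case: ifP => // /andP[/eqP-> /ltnW].
Qed.

Lemma push_new closed open y :
  (exists2 z, z \in closed & le_state z = le_state y) \/
  (exists2 z, z \in push closed open y & le_state z = le_state y /\ le_g z <= le_g y).
Proof.
rewrite /push; case: hasP => [[z zC /eqP]|_]; first by left; exists z.
right; case: hasP => [[z zO /eqP eq_z]|_]; last by exists y; rewrite ?mem_head.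
exists (if (le_state z == le_state y) && (le_g y < le_g z) then y else z).
  exact: (map_f _ zO).
by rewrite eq_z eqxx /=; case: ltnP.
Qed.

Lemma push_uniq closed open y :
  uniq (map (@le_state V) (open ++ closed)) ->
  uniq (map (@le_state V) (push closed open y ++ closed)).
Proof.
rewrite /push; case: hasP => [//|nC]; case: hasP => [_|nO] uOC.
  rewrite map_cat -map_comp (_ : map _ open = map (@le_state V) open) -?map_cat //.
  by apply: eq_map => z /=; case: ifP => // /andP[/eqP].
rewrite /= uOC andbT; apply/mapP=> -[z]; rewrite mem_cat => /orP[zO|zC] eq_z.
  by case: nO; exists z; rewrite // eq_z.
by case: nC; exists z; rewrite // eq_z.
Qed.

Lemma mem_foldl_push closed open s z :
  z \in foldl (push closed) open s -> z \in open \/ z \in s.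
Proof.
elim: s open => [|y s IH] open /=; first by left.
case/IH=> [/mem_push[|->]|zs]; [by left | right; exact: mem_head | right].
by rewrite inE zs orbT.
Qed.

Lemma foldl_push_keep closed open s z : z \in open ->
  exists2 z', z' \in foldl (push closed) open s &
    le_state z' = le_state z /\ le_g z' <= le_g z.
Proof.
elim: s open z => [|y s IH] open z zO /=; first by exists z.
have [z1 /IH[z2 z2P [eq_z2 le_z2]] [eq_z1 le_z1]] := push_keep closed y zO.
by exists z2; rewrite // eq_z2 eq_z1; split=> //; apply: leq_trans le_z1.
Qed.

Lemma foldl_push_new closed open s y : y \in s ->
  (exists2 z, z \in closed & le_state z = le_state y) \/
  (exists2 z, z \in foldl (push closed) open s &
     le_state z = le_state y /\ le_g z <= le_g y).
Proof.
elim: s open => [//|x s IH] open; rewrite inE => /predU1P[->|/IH]; last exact.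
have [|[z zP [eq_z le_z]]] := push_new closed open x; [by left | right].
have [z' z'P [eq_z' le_z']] := foldl_push_keep closed s zP.
by exists z'; rewrite // eq_z' eq_z; split=> //; apply: leq_trans le_z.
Qed.

Lemma foldl_push_uniq closed open s :
  uniq (map (@le_state V) (open ++ closed)) ->
  uniq (map (@le_state V) (foldl (push closed) open s ++ closed)).
Proof. by elim: s open => [|y s IH] open //= /(push_uniq y)/IH. Qed.

End Push.

Section AStar.
Variables (V : finType) (I : mapf_instance V) (C : seq (constraint I)).
Variables (a : 'I_(nb_agents I)) (F : tis V -> seq (tnode V)).
Hypothesis forestF : TIS_forest C a F.
Hypothesis can_wait : forall t v, edge_constraint a t v v \notin C.

(* The states X = (L, p) that a constraint-satisfying walk of the agent can be
   charged with at time t, when it has collected the goals L and stands in p. *)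
Inductive reach (p0 : tis V) : lstate V -> nat -> Prop :=
| ReachInit : reach p0 (set0, p0) 0
| ReachStep X t q t' w : reach p0 X t -> transition C a X q -> t <= t' ->
    walk_allowed C a w t t' -> w t = X.2.2 -> w t' = q.2 -> tin q.1 t' ->
    reach p0 (q.2 |: X.1, q) t'.

Lemma reach_SI p0 X t : is_SI C a p0 -> tin p0.1 0 -> reach p0 X t ->
  is_SI C a X.2 /\ tin X.2.1 t.
Proof. by move=> p0SI p0_0; case=> // ? ? q t' w _ [[qSI _] _ _]. Qed.

Lemma successorP x q y : successor F x q = Some y ->
  exists2 c, query_length (F q) (le_g x) (le_state x).2.2 = Some c &
    y = LEntry (q.2 |: (le_state x).1, q) (le_g x + c) (Some (le_state x)).
Proof. by rewrite /successor; case: query_length => //= c [<-]; exists c. Qed.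

(** The agent, present at time [le_g x], waits in its SI until [t] and then follows [w]; the tree of
    [q] finds a walk at least as short. *)
Lemma successor_le x q t t' w : is_SI C a (le_state x).2 ->
  tin (le_state x).2.1 (le_g x) -> tin (le_state x).2.1 t -> le_g x <= t ->
  transition C a (le_state x) q -> t <= t' -> walk_allowed C a w t t' ->
  w t = (le_state x).2.2 -> w t' = q.2 -> tin q.1 t' ->
  exists2 y, successor F x q = Some y & le_g y <= t'.
Proof.
move=> [_ xSI _] x_g x_t le_gt [qGSI _ _] le_tt' [safe_w move_w] w_t w_t' q_t'.
pose w' s := if s < t then (le_state x).2.2 else w s.
have w'_t' : w' t' = q.2 by rewrite /w' ltnNge le_tt'.
have w'_g : w' (le_g x) = (le_state x).2.2.
  by rewrite /w'; case: ltnP => // le_tg; rewrite -w_t; congr w; lia.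
have def_t' : le_g x + (t' - le_g x) = t' by lia.
have [|||c] := @query_length_le _ _ _ _ _ _ qGSI.1 (forestF qGSI) w' (le_g x) (t' - le_g x);
  rewrite ?def_t' //.
  split=> s s_in; rewrite /w'; have [lt_st|le_ts] := ltnP s t.
  - apply: xSI; move: x_g x_t; rewrite /tin; case: (_.2.1.2) => [e|] /=; lia.
  - by apply: safe_w; lia.
  - rewrite /move_allowed; case: ltnP => [_|le_ts1].
      by rewrite /step /= eqxx can_wait.
    have -> : s.+1 = t by lia.
    by rewrite w_t /step /= eqxx can_wait.
  by case: ltnP => [|_]; [lia | apply: move_w; lia].
rewrite w'_g /successor => ->; move=> le_c /=; eexists; first by [].
by rewrite /=; lia.
Qed.

(** After the transition, the tree spans exactly the goals unvisited in [X], [q.2] being one of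
    them. Attaching the vertex of [X] to [q.2] costs at most the duration of the walk. *)
Lemma h_value_consistent X t q t' w : transition C a X q -> t <= t' ->
  walk_allowed C a w t t' -> w t = X.2.2 -> w t' = q.2 ->
  xle (h_value a X) (xadd (Some (t' - t)) (h_value a (q.2 |: X.1, q))).
Proof.
move=> [[_ q_goal] q_new _] le_tt' [_ move_w] w_t w_t'.
have qU : q.2 \in goals a :\: X.1 by rewrite inE q_new.
have -> : h_value a (q.2 |: X.1, q) = mst_cost (edge I) (goals a :\: X.1).
  rewrite /h_value /=; congr mst_cost.
  apply/setP=> v; rewrite !inE; case: eqVneq => [->|//].
  by rewrite q_goal q_new.
apply: xle_trans (mst_cost_setU1 _ _ qU) _; apply: xle_add2r.
have := @dist_le_walk _ I w t (t' - t); rewrite subnKC // w_t w_t'.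
by apply=> s /move_w/andP[].
Qed.

(** The guard [tin p0.1 0] in the last field excludes constraints forbidding the start vertex at
    time 0, for which the earliest SI begins later. *)
Record astar_inv (p0 : tis V) (open closed : seq (lentry V)) : Prop := AstarInv {
  ai_init : earliest_SI C a (start a) p0;
  ai_uniq : uniq (map (@le_state V) (open ++ closed));
  ai_origin : forall z, z \in open ++ closed -> z = LEntry (set0, p0) 0 None \/
    exists y q, [/\ y \in closed, transition C a (le_state y) q
                  & successor F y q = Some z];
  ai_incomplete : forall z, z \in closed -> ~~ (goals a \subset (le_state z).1);
  ai_start : exists2 z, z \in open ++ closed & le_state z = (set0, p0) /\ le_g z = 0;
  ai_succ : forall x q y, x \in closed -> transition C a (le_state x) q ->
    successor F x q = Some y ->
    (exists2 z, z \in closed & le_state z = le_state y) \/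
    (exists2 z, z \in open & le_state z = le_state y /\ le_g z <= le_g y);
  ai_closed_le : tin p0.1 0 -> forall x t hx, x \in closed ->
    reach p0 (le_state x) t -> h_value a (le_state x) = Some hx -> le_g x <= t
}.

Lemma astar_inv_tin p0 open closed z : astar_inv p0 open closed -> tin p0.1 0 ->
  z \in open ++ closed -> tin (le_state z).2.1 (le_g z).
Proof.
move=> inv p0_0 /(ai_origin inv)[-> //|[y [q [_ [qGSI _ _] /successorP[c q_c ->]]]]].
exact: (query_length_tin qGSI.1 (forestF qGSI) q_c).
Qed.

(* Needed when x is closed: its predecessors on an optimal chain are either all
   closed, or dominated by an open entry that A* would have preferred to x. *)
Lemma reach_frontier p0 open closed X t hx : astar_inv p0 open closed ->
  tin p0.1 0 -> reach p0 X t -> h_value a X = Some hx ->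
  (exists2 x, x \in closed & le_state x = X /\ le_g x <= t) \/
  (exists2 z, z \in open & xle (f_value a z) (Some (t + hx))).
Proof.
move=> inv p0_0 reachX; have [p0SI _ _] := ai_init inv.
elim: reachX hx => [|{}X {}t q t' w reachX IH tr le_tt' w_ok w_t w_t' q_t'] hx h_X.
  have [z zOC [z_st z_g]] := ai_start inv; move: zOC; rewrite mem_cat => /orP[zO|zC].
    by right; exists z; rewrite // /f_value z_st h_X z_g /=.
  by left; exists z; rewrite // z_g.
(* By consistency [t + hx0] is at most [t' + hx], so an open entry bounded for the predecessor is
   bounded here too. *)
have := h_value_consistent tr le_tt' w_ok w_t w_t'.
rewrite h_X; case h_X0: (h_value a X) => [hx0|] // le_h.
have [[x xC [def_X x_le]]|[z zO le_z]] := IH _ h_X0; last first.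
  by right; exists z => //; apply: xle_trans le_z _; move: le_h => /=; lia.
have [XSI X_t] := reach_SI p0SI p0_0 reachX; rewrite -def_X in XSI X_t tr w_t.
have x_g : tin (le_state x).2.1 (le_g x).
  by apply: astar_inv_tin inv p0_0 _; rewrite mem_cat xC orbT.
have [y x_y le_y] := successor_le XSI x_g X_t x_le tr le_tt' w_ok w_t w_t' q_t'.
have y_st : le_state y = (q.2 |: X.1, q).
  by have [c _ ->] := successorP x_y; rewrite /= def_X.
have reachY : reach p0 (q.2 |: X.1, q) t'.
  by apply: ReachStep reachX _ le_tt' w_ok _ w_t' q_t'; rewrite -def_X.
have [[z zC z_st]|[z zO [z_st z_g]]] := ai_succ inv xC tr x_y.
  rewrite y_st in z_st; left; exists z; rewrite ?z_st //; split=> //.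
  by apply: (ai_closed_le inv p0_0 zC (hx := hx)); rewrite z_st.
right; exists z; rewrite // /f_value z_st y_st h_X /=; lia.
Qed.

Lemma open_closed_state p0 open closed x y : astar_inv p0 open closed ->
  x \in open ++ closed -> y \in open ++ closed -> le_state x = le_state y -> x = y.
Proof.
move=> /ai_uniq; elim: (_ ++ _) => //= z s IH /andP[z_s /IH{}IH].
rewrite !inE => /predU1P[->|xs] /predU1P[->|ys] // eq_st; last exact: IH.
  by case/negP: z_s; rewrite eq_st map_f.
by case/negP: z_s; rewrite -eq_st map_f.
Qed.

Lemma astar_run_inv open closed : astar_run C a F open closed ->
  exists p0, astar_inv p0 open closed.
Proof.
elim=> {open closed} [p0 p0P|open closed x qs _ [p0 inv] [xO min_x] incomplete qsP].
  exists p0; split=> //; first by move=> z; rewrite inE => /eqP->; left.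
  by exists (LEntry (set0, p0) 0 None); rewrite ?mem_head.
exists p0; have perm_x : perm_eq (open ++ closed) (rem x open ++ x :: closed).
  rewrite perm_sym (perm_catCA (rem x open) [:: x] closed) /= -cat_cons.
  by rewrite perm_cat2r perm_sym perm_to_rem.
have uniq_x : uniq (map (@le_state V) (rem x open ++ x :: closed)).
  by rewrite -(perm_uniq (perm_map _ perm_x)) (ai_uniq inv).
have remO z : z \in rem x open -> z \in open by apply: mem_rem.
have keep z : z \in open ++ closed -> z \in x :: closed \/
    exists2 z', z' \in foldl (push (x :: closed)) (rem x open) (pmap (successor F x) qs) &
      le_state z' = le_state z /\ le_g z' <= le_g z.
  rewrite (perm_mem perm_x) mem_cat => /orP[zO|]; last by left.
  by right; apply: foldl_push_keep.
have x_new y : y \in closed -> le_state y <> le_state x.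
  move: uniq_x; rewrite map_cat cat_uniq => /and3P[_ _ /= /andP[x_C _]] yC eq_st.
  by case/negP: x_C; rewrite -eq_st map_f.
split.
- exact: ai_init inv.
- exact: foldl_push_uniq.
- move=> z zP; have : z \in open ++ closed \/ z \in pmap (successor F x) qs.
    move: zP; rewrite (perm_mem perm_x) !mem_cat => /orP[/mem_foldl_push[]|->] //.
    - by move=> ->; left.
    - by right.
    by left; rewrite orbT.
  case=> [/(ai_origin inv)[|[y [q [yC tr y_z]]]]|]; first by left.
    by right; exists y, q; rewrite inE yC orbT.
  rewrite mem_pmap => /mapP[q /qsP tr x_z].
  by right; exists x, q; rewrite mem_head.
- by move=> z; rewrite inE => /predU1P[->|/(ai_incomplete inv)].
- have [z /keep[zC|[z' z'P [z'_st le_z']]] [z_st z_g]] := ai_start inv.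
    by exists z; rewrite // mem_cat zC orbT.
  by exists z'; [rewrite mem_cat z'P | rewrite z'_st; split=> //; lia].
- move=> y q z; rewrite inE => /predU1P[->|yC] tr y_z.
    by apply: foldl_push_new; rewrite mem_pmap -y_z; apply/map_f/qsP.
  have [[u uC u_st]|[u uO [u_st u_g]]] := ai_succ inv yC tr y_z.
    by left; exists u; rewrite // inE uC orbT.
  have [|uC|[u' u'P [u'_st u'_g]]] := keep u; first by rewrite mem_cat uO.
    by left; exists u.
  by right; exists u'; rewrite // u'_st; split=> //; apply: leq_trans u_g.
move=> p0_0 y t hy; rewrite inE => /predU1P[->|yC] reach_y h_y; last first.
  exact: ai_closed_le inv p0_0 y t hy yC reach_y h_y.
(* Before the expansion the state of [x] is not closed, so some open entry has [f] at most [t + hy];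
   as [x] has minimum [f], it arrives no later than [t]. *)
have [[z zC [z_st _]]|[z zO f_z]] := reach_frontier inv p0_0 reach_y h_y.
  by case: (x_new z).
have := xle_trans (min_x z zO) f_z.
by rewrite /f_value h_y /= leq_add2r.
Qed.

(** This reconciles [concat_paths], which proceeds from the head of the order, with [backtrack],
    which extends it at the end. *)
Lemma concat_paths_rcons t v qs q l : concat_paths F t v (rcons qs q) l ->
  exists l1 l2, [/\ l = l1 ++ l2, concat_paths F t v qs l1
    & query_path q (F q) (t + size l1) (last v [seq p.2 | p <- qs]) l2].
Proof.
elim: qs t v l => [|p qs IH] t v l /= cl.
  inversion cl as [|? ? ? ? l1 l2 q_l1 c_l2]; subst.
  exists [::], l1; split=> //; last by rewrite addn0.
    by inversion c_l2; rewrite cats0.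
  exact: ConcatNil.
inversion cl as [|? ? ? ? l1 l2 q_l1 c_l2]; subst.
have [l3 [l4 [-> c_l3 q_l4]]] := IH _ _ _ c_l2.
exists (l1 ++ l3), l4; split; first by rewrite catA.
  exact: ConcatCons.
by rewrite size_cat addnA.
Qed.

(** The path built up to an entry has length [le_g], so the next tree query is made at the very time
    at which the search made it. *)
Lemma backtrack_path p0 open closed x qs l : astar_inv p0 open closed ->
  x \in open ++ closed -> backtrack closed x qs -> concat_paths F 0 (start a) qs l ->
  [/\ size l = le_g x, path (step I) (start a) l, last (start a) l = (le_state x).2.2,
      last (start a) [seq q.2 | q <- qs] = (le_state x).2.2
    & (le_state x).1 \subset start a :: l].
Proof.
move=> inv xP bt; elim: bt l xP => {x qs} [x x_par|x y qs x_par yC _ IH] l xP cl.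
  inversion cl; subst; have [-> /=|[y [q [_ _ /successorP[c _ def_x]]]]] := ai_origin inv xP.
    by have [_ -> _] := ai_init inv; split=> //; apply/subsetP=> v; rewrite inE.
  by rewrite def_x in x_par.
have [def_x|[y' [q [y'C tr y'_x]]]] := ai_origin inv xP.
  by rewrite def_x in x_par.
have [c q_c def_x] := successorP y'_x.
(* The entry that generated [x] and the backtracked one have the same state, hence coincide. *)
have def_y : y' = y.
  apply: (open_closed_state inv); rewrite ?mem_cat ?y'C ?yC ?orbT //.
  by move: x_par; rewrite def_x => -[].
rewrite {}def_y in tr q_c def_x *; rewrite def_x /= in cl *.
have [l1 [l2 [-> c_l1 q_l2]]] := concat_paths_rcons cl.
have [|size_l1 path_l1 last_l1 last_qs sub_l1] := IH _ _ c_l1.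
  by rewrite mem_cat yC orbT.
have [qGSI _ _] := tr; rewrite add0n size_l1 last_qs in q_l2.
have [size_l2 path_l2 last_l2] := query_pathP qGSI.1 (forestF qGSI) q_c q_l2.
rewrite size_cat size_l1 size_l2 cat_path path_l1 last_l1 path_l2 last_cat last_l1 last_l2.
split=> //; first by rewrite map_rcons last_rcons.
apply/subsetP=> v /setU1P[->|vL]; rewrite -cat_cons mem_cat.
  have : last (last (start a) l1) l2 \in last (start a) l1 :: l2 by apply: mem_last.
  by rewrite last_l1 last_l2 inE => /predU1P[->|->]; rewrite ?orbT // -last_l1 mem_last.
by rewrite (subsetP sub_l1).
Qed.

Lemma astar_is_path l : astar C a F (Some l) -> is_path a l.
Proof.
move=> res; inversion res as [open closed x qs l' run [xO _] complete bt cl def_l|].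
have [p0 inv] := astar_run_inv run.
have xP : x \in open ++ closed by rewrite mem_cat xO.
have [_ path_l last_l _ sub_l] := backtrack_path inv xP bt cl.
split=> //; first exact: subset_trans complete sub_l.
(* The initial entry has visited no goal, so [x] comes from a transition into a GSI. *)
rewrite last_l; have [def_x|[y [q [_ [[_ q_goal] _ _]]]]] := ai_origin inv xP.
  by move: complete; rewrite def_x /= subset0 (negPf (goals_neq0 a)).
by move=> /successorP[c _ ->].
Qed.

(** * Comparison of the search with a path obeying the constraints *)

Section Optimality.
Variable p : seq V.
Let w t := nth (last (start a) p) (start a :: p) t.
Hypotheses (p_path : is_path a p) (p_safe : forall t, safe C a t (w t)).
Hypothesis p_moves : forall t, edge_constraint a t (w t) (w t.+1) \notin C.

Let w_end t : size p <= t -> w t = last (start a) p.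
Proof.
rewrite /w leq_eqVlt => /predU1P[<-|lt_t]; last by rewrite nth_default.
by rewrite -[size p]/(size (start a :: p)).-1 nth_last.
Qed.

Let w_allowed t t' : walk_allowed C a w t t'.
Proof.
split=> s _; rewrite ?p_safe // /move_allowed p_moves andbT.
have [lt_s|le_s] := ltnP s (size p); last by rewrite !w_end ?(leqW le_s) /step /= ?eqxx.
by case: p_path => /(pathP (last (start a) p))/(_ s lt_s).
Qed.

Let SI_at t : exists q, [/\ is_SI C a q, q.2 = w t & tin q.1 t].
Proof.
have [J [maxJ tJ]] := max_tint_exists (S := safe C a ^~ (w t)) (p_safe t).
by exists (J, w t).
Qed.

(** The path [p] makes the start safe at time 0; the SI around that instant begins at 0, and [p0]
    begins no later. *)
Lemma earliest_SI_tin0 p0 : earliest_SI C a (start a) p0 -> tin p0.1 0.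
Proof.
move=> [[ne _ _] _ min_p0]; have [q [qSI q_v q_0]] := SI_at 0.
have := min_p0 q qSI q_v; move: ne q_0; rewrite /tin /tint_nonempty.
by case: (p0.1) => b e /=; case: e => [e|] /=; lia.
Qed.

Lemma path_reaches_goals p0 : earliest_SI C a (start a) p0 ->
  exists X, [/\ reach p0 X (size p), goals a \subset X.1 & h_value a X = Some 0].
Proof.
move=> p0P; have [_ p_goals last_goal] := p_path; set glast := last _ p in last_goal.
(* Here [s] is the time of the latest collection before [t], or 0. As [glast] stays uncollected, no
   transition so far completes the goals, and the restriction to the latest GSI does not arise. *)
have prefix t : exists X s, [/\ reach p0 X s, s <= t, w s = X.2.2, glast \notin X.1
    & forall r, r < t -> w r \in goals a -> w r != glast -> w r \in X.1].
  elim: t => [|t [X [s [reachX le_st w_s nlast X_in]]]].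
    exists (set0, p0), 0; split=> //; [exact: ReachInit | | by rewrite inE].
    by case: p0P => _ ->.
  have [/and3P[t_goal t_last t_new]|/and3P t_old] :=
    boolP [&& w t \in goals a, w t != glast & w t \notin X.1]; last first.
    exists X, s; split=> //; first exact: leqW.
    move=> r; rewrite ltnS leq_eqVlt => /predU1P[->|lt_rt] r_goal r_last.
      by apply: contraT => r_new; case: t_old.
    exact: X_in.
  have [q [qSI q_v q_t]] := SI_at t.
  have tr : transition C a X q.
    split; rewrite ?q_v //; first by split; rewrite ?q_v.
    move/setP/(_ glast); rewrite !inE nlast last_goal => /esym/eqP eq_last.
    by rewrite eq_last eqxx in t_last.
  exists (q.2 |: X.1, q), t; split=> //.
  - exact: ReachStep reachX tr le_st (w_allowed s t) w_s (esym q_v) q_t.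
  - by rewrite inE negb_or nlast andbT inE q_v eq_sym.
  move=> r; rewrite ltnS leq_eqVlt /= => /predU1P[-> _ _|lt_rt r_goal r_last].
    by rewrite q_v setU11.
  by rewrite inE X_in ?orbT.
have [X [s [reachX le_s w_s nlast X_in]]] := prefix (size p).
have [[J v] [qSI /= q_v q_T]] := SI_at (size p).
rewrite w_end // -/glast in q_v; rewrite {v}q_v in qSI.
have goalsX : goals a \subset glast |: X.1.
  apply/subsetP=> v v_goal; have := subsetP p_goals v v_goal.
  case/(nthP glast)=> r /=; rewrite ltnS => le_r w_r; rewrite in_setU1.
  case: eqVneq => //= v_last; rewrite -w_r; apply: X_in; rewrite -?[nth _ _ _]/(w r).
  - rewrite ltn_neqAle le_r andbT; apply: contra v_last => /eqP def_r.
    by rewrite -w_r -/(w r) w_end // def_r.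
  - by rewrite /w w_r.
  by rewrite /w w_r.
(* The agent rests at [glast] from time [size p] on, so this SI is unbounded; one beginning later
   would be strictly inside it. *)
have latest : latest_SI C a glast (J, glast).
  split=> // -[J' v] [ne' S' max'] /= def_v; rewrite def_v in S' max'.
  have [ne SJ maxJ] := qSI; have J_inf : J = (J.1, None).
    symmetry; apply: maxJ => //.
      move=> t /andP[/= le_t _]; have [lt_t|le_Tt] := ltnP t (size p).
        by apply: SJ; move: q_T; rewrite /tin /= le_t; case: (J.2) => //= e; lia.
      by rewrite -[glast]/(last _ _) -(w_end le_Tt) p_safe.
    by move=> t /andP[le_t _]; rewrite /tin /= le_t.
  rewrite leqNgt; apply/negP=> lt_J.
  have : J = J'.
    apply: max' => // t /andP[le_t _]; rewrite J_inf /tin /= andbT.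
    by apply: leq_trans le_t; apply: ltnW.
  by move=> def_J; rewrite def_J ltnn in lt_J.
exists (glast |: X.1, (J, glast)); split=> //.
  have tr : transition C a X (J, glast) by split.
  by apply: ReachStep reachX tr le_s (w_allowed _ _) w_s _ q_T; apply: w_end.
rewrite /h_value /= (_ : goals a :\: _ = set0) ?setU0 ?mst_cost_set1 //.
by apply/eqP; rewrite setD_eq0.
Qed.

(** With an empty open set, [reach_frontier] yields a closed state with all goals visited, but such
    states are never expanded. *)
Lemma astar_failure : ~ astar C a F None.
Proof.
move=> res; inversion res as [|closed run]; have [p0 inv] := astar_run_inv run.
have [X [reachX X_goals h_X]] := path_reaches_goals (ai_init inv).
have p0_0 := earliest_SI_tin0 (ai_init inv).
have [[x xC [def_X _]]|[z]] := reach_frontier inv p0_0 reachX h_X; last by [].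
by have := ai_incomplete inv xC; rewrite def_X X_goals.
Qed.

(** Some open entry has [f] at most [size p]; the answer has minimum [f], and its heuristic value is
    0. *)
Lemma astar_optimal l : astar C a F (Some l) -> size l <= size p.
Proof.
move=> res; inversion res as [open closed x qs l' run [xO min_x] complete bt cl def_l|].
have [p0 inv] := astar_run_inv run.
have [X [reachX X_goals h_X]] := path_reaches_goals (ai_init inv).
have p0_0 := earliest_SI_tin0 (ai_init inv).
have xP : x \in open ++ closed by rewrite mem_cat xO.
have [-> _ _ _ _] := backtrack_path inv xP bt cl.
have [[z zC [def_X _]]|[z zO f_z]] := reach_frontier inv p0_0 reachX h_X.
  by have := ai_incomplete inv zC; rewrite def_X X_goals.
have := xle_trans (min_x z zO) f_z; rewrite /f_value /h_value.
rewrite (_ : goals a :\: _ = set0) ?setU0 ?mst_cost_set1 /= ?addn0 //.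
by apply/eqP; rewrite setD_eq0.
Qed.

End Optimality.
End AStar.

(** * The constraint tree *)

Section HighLevel.
Variables (V : finType) (I : mapf_instance V).
Implicit Types (C : seq (constraint I)) (P Q : plan I) (N : hnode I).

(** A form of [pos] that needs no plan: [pos P a] is convertible to [path_pos a (P a)]. *)
Definition path_pos (a : 'I_(nb_agents I)) (p : seq V) (t : nat) : V :=
  nth (last (start a) p) (start a :: p) t.

Definition path_respects C (a : 'I_(nb_agents I)) (p : seq V) : Prop :=
  forall t, safe C a t (path_pos a p t) /\
    edge_constraint a t (path_pos a p t) (path_pos a p t.+1) \notin C.

Definition respects C Q : Prop := forall a, path_respects C a (Q a).

(* The search relies on waiting inside safe intervals, which a constraint on a
   loop (v, v) would forbid; edge conflicts only produce constraints on moves. *)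
Definition waits_allowed C : Prop :=
  forall a t v, edge_constraint a t v v \notin C.

Lemma low_level_is_path C a l :
  waits_allowed C -> low_level C a (Some l) -> is_path a l.
Proof. by move=> waitC [F forestF]; apply: astar_is_path. Qed.

Lemma low_level_optimal C a l p : waits_allowed C -> low_level C a (Some l) ->
  is_path a p -> path_respects C a p -> size l <= size p.
Proof.
move=> waitC [F forestF res] p_path p_ok.
by apply: (astar_optimal forestF _ p_path _ _ res) => // t; case: (p_ok t).
Qed.

(** Ensures that no child is discarded while a solution respects its constraints. *)
Lemma low_level_complete C a p : waits_allowed C -> is_path a p ->
  path_respects C a p -> ~ low_level C a None.
Proof.
move=> waitC p_path p_ok [F forestF].
by apply: (astar_failure forestF _ p_path) => // t; case: (p_ok t).
Qed.

Lemma path_respects_cons c C a p :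
  path_respects (c :: C) a p -> path_respects C a p.
Proof.
move=> p_ok t; have [] := p_ok t; rewrite /safe !inE !negb_or.
by move=> /andP[_ ->] /andP[_ ->].
Qed.

Lemma respects_vertex C Q i t v : respects C Q -> pos Q i t != v ->
  respects (vertex_constraint i t v :: C) Q.
Proof.
move=> Q_ok Q_v b s; have [Q_s Q_e] := Q_ok b s.
rewrite /safe !inE !negb_or; split; last exact: Q_e.
by rewrite [X in _ && X]Q_s andbT; apply: contra Q_v => /eqP[-> -> <-].
Qed.

Lemma respects_edge C Q i t u v : respects C Q ->
  ~~ ((pos Q i t == u) && (pos Q i t.+1 == v)) ->
  respects (edge_constraint i t u v :: C) Q.
Proof.
move=> Q_ok Q_uv b s; have [Q_s Q_e] := Q_ok b s.
rewrite /safe !inE !negb_or; split; first exact: Q_s.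
rewrite [X in _ && X]Q_e andbT; apply: contra Q_uv => /eqP[-> -> <- <-].
by rewrite /pos !eqxx.
Qed.

(** If [Q] broke both new constraints, it would contain the same collision. *)
Lemma respects_conflict C P Q i j t ci cj : conflict P i j t ci cj ->
  collision_free Q -> respects C Q ->
  respects (ci :: C) Q \/ respects (cj :: C) Q.
Proof.
case=> [ne_ij eq_P|ne_ij mv_i mv_j eq_P] free_Q Q_ok.
  have [Q_i|Q_i] := eqVneq (pos Q i t) (pos P i t); last by left; apply: respects_vertex.
  right; apply: respects_vertex => //; apply/eqP=> Q_j.
  by apply: free_Q (VertexConflict ne_ij (t := t) _); rewrite Q_i Q_j.
have [/andP[/eqP Q_i /eqP Q_i']|Q_i] :=
  boolP ((pos Q i t == pos P i t) && (pos Q i t.+1 == pos P i t.+1)); last first.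
  by left; apply: respects_edge.
right; apply: respects_edge => //; apply/negP=> /andP[/eqP Q_j /eqP Q_j'].
by apply: free_Q (EdgeConflict ne_ij (t := t) _ _ _); rewrite ?Q_i ?Q_i' ?Q_j ?Q_j'.
Qed.

(** In an edge conflict both agents change vertex, so neither new constraint concerns a loop. *)
Lemma waits_allowed_conflict C P i j t ci cj : conflict P i j t ci cj ->
  waits_allowed C -> waits_allowed (ci :: C) /\ waits_allowed (cj :: C).
Proof.
case=> [ne_ij _|ne_ij mv_i mv_j _] waitC; split=> b s v;
  rewrite inE negb_or waitC andbT //; apply/eqP=> -[_ _ eq_u eq_v].
  by rewrite -eq_u -eq_v eqxx in mv_i.
by rewrite -eq_u -eq_v eqxx in mv_j.
Qed.

(** The bound ranges over the paths respecting the constraints, so it persists when constraints are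
    added; a child thus inherits it for the agents whose path is kept. *)
Definition node_optimal N : Prop :=
  waits_allowed N.1 /\ forall a, is_path a (N.2 a) /\
    forall p, is_path a p -> path_respects N.1 a p -> size (N.2 a) <= size p.

Lemma node_optimal_soc N Q : node_optimal N -> solution Q -> respects N.1 Q ->
  soc N.2 <= soc Q.
Proof.
move=> [_ optN] [Q_paths _] Q_ok; apply: leq_sum => a _.
by have [_] := optN a; apply.
Qed.

Lemma child_optimal N M a c r : node_optimal N -> waits_allowed (c :: N.1) ->
  low_level (c :: N.1) a r -> M \in child N a c r -> node_optimal M.
Proof.
move=> [_ optN] waitC; case: r => [l|] //= res; rewrite inE => /eqP->.
split=> // b; rewrite ffunE; case: eqP => [->|_].
  by split=> [|p]; [apply: low_level_is_path res | apply: low_level_optimal res].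
have [N_path N_opt] := optN b; split=> // p p_path /path_respects_cons.
exact: N_opt.
Qed.

Lemma child_respects N Q a c r : waits_allowed (c :: N.1) ->
  low_level (c :: N.1) a r -> solution Q -> respects (c :: N.1) Q ->
  exists2 M, M \in child N a c r & respects M.1 Q.
Proof.
move=> waitC res [Q_paths _] Q_ok; case: r res => [l|] res.
  by eexists; [apply: mem_head | ].
by case: (low_level_complete waitC (Q_paths a) (Q_ok a) res).
Qed.

(** When a node is expanded, each solution respecting its constraints respects those of one of its
    children, which the low-level solver cannot fail to produce. *)
Lemma mgcbs_run_inv open : mgcbs_run open ->
  (forall N, N \in open -> node_optimal N) /\
  (forall Q, solution Q -> exists2 N, N \in open & respects N.1 Q).
Proof.
elim=> {open} [P rootP|open N i j ci cj ri rj _ [optO respO] [NO _] [t cfl _] res_i res_j].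
  split=> [N|Q _]; last by exists ([::], P); rewrite ?mem_head.
  rewrite inE => /eqP->; split=> // a.
  by split=> [|p]; [apply: low_level_is_path (rootP a) | apply: low_level_optimal (rootP a)].
have optN := optO N NO; have [wait_i wait_j] := waits_allowed_conflict cfl optN.1.
split=> [M|Q Q_sol].
  rewrite !mem_cat => /or3P[|| /mem_rem/optO //].
    exact: child_optimal optN wait_i res_i.
  exact: child_optimal optN wait_j res_j.
have [M MO Q_ok] := respO Q Q_sol.
move: MO; rewrite (perm_mem (perm_to_rem NO)) inE => /predU1P[def_M|M_rem]; last first.
  by exists M; rewrite // !mem_cat M_rem !orbT.
rewrite def_M in Q_ok.
have [Q_i|Q_j] := respects_conflict cfl Q_sol.2 Q_ok.
  have [M' M'P ?] := child_respects wait_i res_i Q_sol Q_i.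
  by exists M'; rewrite // !mem_cat M'P.
have [M' M'P ?] := child_respects wait_j res_j Q_sol Q_j.
by exists M'; rewrite // !mem_cat M'P orbT.
Qed.

End HighLevel.

Theorem theorem2 (V : finType) (I : mapf_instance V) (P : plan I) :
  mgcbs_returns P ->
  solution P /\ (forall Q : plan I, solution Q -> soc P <= soc Q).
Proof.
move=> [open [N [run [NO min_N] free_N ->]]].
have [optO respO] := mgcbs_run_inv run.
split=> [|Q Q_sol]; first by split=> // a; have [_ /(_ a)[]] := optO N NO.
(* The SOC of [M] lies between the minimum, attained by [N], and that of [Q]. *)
have [M MO Q_ok] := respO Q Q_sol.
exact: leq_trans (min_N M MO) (node_optimal_soc (optO M MO) Q_sol Q_ok).
Qed.
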